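(* The Bernoulli coalgebra $\mathrm{bern}$, i.e. the channel from $[0,1]$ to $2\times[0,1]$ given by $\mathrm{bern}(r) = r\,|1,r\rangle + (1-r)\,|0,r\rangle$, is the final exchangeable coalgebra for the functor $2\times(-)$ on the Kleisli category $\mathcal{K}\ell(\mathcal{G})$ of the Giry monad. That is: $\mathrm{bern}$ is exchangeable, and for every measurable space $X$ and every exchangeable coalgebra $h$ from $X$ to $2\times X$ there is a unique channel $f$ from $X$ to $[0,1]$ such that $\mathrm{bern}\circ f = (\mathrm{id}\otimes f)\circ h$ (as channels from $X$ to $2\times[0,1]$, with $\circ$ denoting Kleisli composition).
   Context: Giry monad and channels. For a measurable space $X$, $\mathcal{G}(X)$ is the set of probability measures on $X$, with the least $\sigma$-algebra making the sets $\{\omega \mid \omega(U)<r\}$ measurable for all measurable $U\subseteq X$ and all real $r$. A channel from $X$ to $Y$ (a morphism of $\mathcal{K}\ell(\mathcal{G})$) is a measurable function $f\colon X\to\mathcal{G}(Y)$. Kleisli composition is $(g\circ f)(x)(U)=\int_Y g(y)(U)\,f(x)(\mathrm{d}y)$. Here $2=\{0,1\}$ with all subsets measurable, $[0,1]$ has the Borel $\sigma$-algebra, and products of measurable spaces have the product $\sigma$-algebra. The formal sum $\sum_i r_i|x_i\rangle$ denotes the discrete probability measure $\sum_i r_i\delta_{x_i}$. The functor $2\times(-)$ on $\mathcal{K}\ell(\mathcal{G})$ sends a channel $f$ from $X$ to $Y$ to the channel $\mathrm{id}\otimes f$ from $2\times X$ to $2\times Y$, with $(\mathrm{id}\otimes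 f)(b,x)=\delta_b\otimes f(x)$ (product measure). A coalgebra is a channel $h$ from $X$ to $2\times X$. A coalgebra $h$ from $X$ to $2\times X$ is exchangeable if $(\mathrm{swap}\times\mathrm{id}_X)\circ(\mathrm{id}\otimes h)\circ h = (\mathrm{id}\otimes h)\circ h$ as channels from $X$ to $2\times 2\times X$, where $\mathrm{swap}\colon 2\times 2\to 2\times 2$, $\mathrm{swap}(a,b)=(b,a)$, and the function $\mathrm{swap}\times\mathrm{id}_X$ is regarded as a deterministic channel; the first copy of $2$ in $2\times2\times X$ records the output of the first application of $h$ and the second copy that of the second application. *)

(* Defs.v *)
From HB Require Import structures.
From mathcomp Require Import all_boot all_order all_algebra.
From mathcomp Require Import all_classical all_reals all_analysis.
From mathcomp Require Import measurable_realfun giry.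

Set Implicit Arguments.
Unset Strict Implicit.
Unset Printing Implicit Defensive.
Import Order.TTheory GRing.Theory Num.Theory.

Local Open Scope classical_set_scope.
Local Open Scope ring_scope.

(* [pprobability Y R] is the set of probability measures on [Y] with the
   sigma-algebra generated by the sets [mset U r], for [U] measurable and [r] in
   [0, 1]; the sets [mset U r] with [r] outside [0, 1] are empty or full.
   Objects of type [measurableType] are inhabited; the only measurable space left
   out is the empty one, which trivially has a unique channel to any space. *)
Definition channel (R : realType) d d' (X : measurableType d)
    (Y : measurableType d') : Type :=
  {mfun X >-> pprobability Y R}.

(* A term of type [probability Y R] is a function on all subsets of [Y], whose
   values on non-measurable subsets are irrelevant; channels are therefore
   compared on measurable sets, rather than by Leibniz equality. *)
Definition channel_eq (R : realType) d d' (X : measurableType d)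
    (Y : measurableType d') (f g : channel R X Y) : Prop :=
  forall (x : X) (U : set Y), measurable U ->
    (f x : probability Y R) U = (g x : probability Y R) U.

Lemma measurable_to_pprobability (R : realType) d d' (X : measurableType d)
    (Y : measurableType d') (f : X -> pprobability Y R) :
  (forall U, measurable U ->
    measurable_fun [set: X] (fun x => (f x : probability Y R) U)) ->
  measurable_fun [set: X] f.
Proof.
move=> mf; apply: (measurability (@pset _ _ _ : set (set (pprobability Y R)))).
  by [].
by move=> _ [_ [r r01] [U mU <-]] <-; apply: emeasurable_fun_infty_o => //;
  exact: mf.
Qed.

Lemma measurable_channel_ev (R : realType) d d' (X : measurableType d)
    (Y : measurableType d') (f : channel R X Y) (U : set Y) : measurable U ->
  measurable_fun [set: X] (fun x => (f x : probability Y R) U).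
Proof.
exact: (measurable_kernel (kprobability (@measurable_funPT _ _ _ _ f))).
Qed.

Section kleisli.
Context (R : realType) d1 d2 d3 (X : measurableType d1) (Y : measurableType d2)
  (Z : measurableType d3) (g : channel R Y Z) (f : channel R X Y).

Definition kleisli_measure (x : X) (U : set Z) : \bar R :=
  (\int[(f x : probability Y R)]_y (g y : probability Z R) U)%E.

Section measure.
Variable x : X.

Let kleisli0 : kleisli_measure x set0 = 0%E.
Proof. by apply: integral0_eq => y _; rewrite measure0. Qed.

Let kleisli_ge0 U : (0 <= kleisli_measure x U)%E.
Proof. by apply: integral_ge0 => y _; exact: measure_ge0. Qed.

Let kleisli_sigma_additive : semi_sigma_additive (kleisli_measure x).
Proof.
exact: (@measure_semi_sigma_additive _ _ _
  (mkcomp_noparam (kprobability (@measurable_funPT _ _ _ _ f))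
                  (kprobability (@measurable_funPT _ _ _ _ g)) x)).
Qed.

HB.instance Definition _ := isMeasure.Build _ _ _ (kleisli_measure x)
  kleisli0 kleisli_ge0 kleisli_sigma_additive.

Let kleisli_setT : kleisli_measure x [set: Z] = 1%E.
Proof.
rewrite /kleisli_measure.
rewrite (eq_integral (cst 1%E)); last first.
  by move=> y _; exact: (@probability_setT _ _ _ (g y : probability Z R)).
rewrite integral_cst// mul1e.
exact: (@probability_setT _ _ _ (f x : probability Y R)).
Qed.

HB.instance Definition _ :=
  Measure_isProbability.Build _ _ _ (kleisli_measure x) kleisli_setT.

End measure.

Definition kleisli_fun (x : X) : pprobability Z R := kleisli_measure x.

Let measurable_kleisli : measurable_fun [set: X] kleisli_fun.
Proof.
apply: measurable_to_pprobability => U mU.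
exact: (measurable_kernel
  (mkcomp_noparam (kprobability (@measurable_funPT _ _ _ _ f))
                  (kprobability (@measurable_funPT _ _ _ _ g)))).
Qed.

HB.instance Definition _ :=
  isMeasurableFun.Build _ _ _ _ kleisli_fun measurable_kleisli.

Definition kleisli : channel R X Z := kleisli_fun.

End kleisli.

Section deterministic.
Context (R : realType) d d' (X : measurableType d) (Y : measurableType d')
  (f : {mfun X >-> Y}).

Definition det_fun (x : X) : pprobability Y R := \d_(f x).

Let measurable_det : measurable_fun [set: X] det_fun.
Proof.
apply: measurable_to_pprobability => U mU.
by apply: (measurableT_comp (measurable_fun_dirac mU)); exact: measurable_funPT.
Qed.

HB.instance Definition _ :=
  isMeasurableFun.Build _ _ _ _ det_fun measurable_det.

Definition det : channel R X Y := det_fun.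

End deterministic.

Section functor.
Context (R : realType) d d' (X : measurableType d) (Y : measurableType d')
  (f : channel R X Y).

Definition id_tensor_fun (p : bool * X) : pprobability (bool * Y)%type R :=
  ((\d_(p.1) : probability bool R) \x (f p.2 : probability Y R))%E.

Let measurable_id_tensor : measurable_fun [set: bool * X] id_tensor_fun.
Proof.
apply: measurable_to_pprobability => U mU.
pose F (p : bool * X) : giry bool R * giry Y R :=
  (\d_(p.1) : subprobability bool R,
   (f p.2 : probability Y R) : subprobability Y R).
have mF : measurable_fun setT F.
  apply: measurable_fun_pair => /=; apply: measurable_giry_codensity => // B mB.
    exact: (measurableT_comp (measurable_fun_dirac mB) measurable_fst).
  exact: (measurableT_comp (measurable_channel_ev f mB) measurable_snd).
exact: (measurableT_comp (measurable_giry_ev mU)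
  (measurableT_comp measurable_giry_prod mF)).
Qed.

HB.instance Definition _ :=
  isMeasurableFun.Build _ _ _ _ id_tensor_fun measurable_id_tensor.

Definition id_tensor : channel R (bool * X)%type (bool * Y)%type :=
  id_tensor_fun.

End functor.

Definition coalgebra (R : realType) d (X : measurableType d) : Type :=
  channel R X (bool * X)%type.

Section swap.
Context d (X : measurableType d).

(* The function swap x id_X, with 2 x 2 x X bracketed as 2 x (2 x X). *)
Definition swap_id_fun (p : bool * (bool * X)) : bool * (bool * X) :=
  (p.2.1, (p.1, p.2.2)).

Let measurable_swap_id : measurable_fun [set: bool * (bool * X)] swap_id_fun.
Proof.
apply: measurable_fun_pair => /=.
  exact: (measurableT_comp measurable_fst measurable_snd).
apply: measurable_fun_pair => /=; first exact: measurable_fst.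
exact: (measurableT_comp measurable_snd measurable_snd).
Qed.

HB.instance Definition _ :=
  isMeasurableFun.Build _ _ _ _ swap_id_fun measurable_swap_id.

Definition swap_id :
  {mfun (bool * (bool * X))%type >-> (bool * (bool * X))%type} := swap_id_fun.

End swap.

Definition exchangeable (R : realType) d (X : measurableType d)
    (h : coalgebra R X) : Prop :=
  channel_eq (kleisli (det R (swap_id X)) (kleisli (id_tensor h) h))
             (kleisli (id_tensor h) h).

Definition unit_interval (R : realType) : Type := {r : R | 0 <= r <= 1}.

Section unit_interval_measurable.
Variable R : realType.

HB.instance Definition _ := Choice.on (unit_interval R).

Let unit_interval_point : 0 <= (0 : R) <= 1.
Proof. by rewrite lexx ler01. Qed.

HB.instance Definition _ :=
  isPointed.Build (unit_interval R) (exist _ 0 unit_interval_point).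

Definition unit_interval_val (r : unit_interval R) : R := sval r.

(* The trace on [0, 1] of the Borel sigma-algebra of R, i.e., the Borel
   sigma-algebra of [0, 1]. *)
Definition unit_interval_measurable : set (set (unit_interval R)) :=
  g_sigma_algebra_preimage unit_interval_val.

Let sigma_algebra_unit_interval :
  sigma_algebra setT unit_interval_measurable.
Proof.
apply: sigma_algebra_preimage.
exact: sigma_algebra_measurable.
Qed.

Let unit_interval_measurable0 : unit_interval_measurable set0.
Proof. by case: sigma_algebra_unit_interval. Qed.

Let unit_interval_measurableC A :
  unit_interval_measurable A -> unit_interval_measurable (~` A).
Proof. by rewrite -setTD; case: sigma_algebra_unit_interval => _ + _; exact. Qed.

Let unit_interval_measurable_bigcup (F : (set (unit_interval R))^nat) :
  (forall i, unit_interval_measurable (F i)) ->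
  unit_interval_measurable (\bigcup_i F i).
Proof. by case: sigma_algebra_unit_interval => _ _; exact. Qed.

HB.instance Definition _ := @isMeasurable.Build
  (preimage_display unit_interval_val) (unit_interval R)
  unit_interval_measurable unit_interval_measurable0
  unit_interval_measurableC unit_interval_measurable_bigcup.

Lemma measurable_unit_interval_val :
  measurable_fun [set: unit_interval R] unit_interval_val.
Proof. by move=> _ B mB; exists B. Qed.

End unit_interval_measurable.

Section bernoulli.
Variable R : realType.

Section measure.
Variable r : unit_interval R.

Definition bern_measure (U : set (bool * unit_interval R)) : \bar R :=
  ((sval r)%:E * \d_(true, r) U + (1 - sval r)%:E * \d_(false, r) U)%E.

Let r_ge0 : 0 <= sval r. Proof. by case: r => /= s /andP[]. Qed.

Let onem_r_ge0 : 0 <= 1 - sval r.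
Proof. by rewrite subr_ge0; case: r => /= s /andP[]. Qed.

Let bernE : bern_measure =
  measure_add (mscale (NngNum r_ge0) \d_(true, r))
              (mscale (NngNum onem_r_ge0) \d_(false, r)).
Proof. by apply/funext => U; rewrite measure_addE. Qed.

Let bern0 : bern_measure set0 = 0%E.
Proof. by rewrite bernE; exact: measure0. Qed.

Let bern_ge0 U : (0 <= bern_measure U)%E.
Proof. by rewrite bernE; exact: measure_ge0. Qed.

Let bern_sigma_additive : semi_sigma_additive bern_measure.
Proof. by rewrite bernE; exact: measure_semi_sigma_additive. Qed.

HB.instance Definition _ := isMeasure.Build _ _ _ bern_measure
  bern0 bern_ge0 bern_sigma_additive.

Let bern_setT : bern_measure setT = 1%E.
Proof. by rewrite /bern_measure !diracT !mule1 -EFinD addrC subrK. Qed.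

HB.instance Definition _ :=
  Measure_isProbability.Build _ _ _ bern_measure bern_setT.

End measure.

Definition bern_fun (r : unit_interval R) :
  pprobability (bool * unit_interval R)%type R := bern_measure r.

Let measurable_bern : measurable_fun [set: unit_interval R] bern_fun.
Proof.
apply: measurable_to_pprobability => U mU.
have mval := @measurable_unit_interval_val R.
have mdirac b : measurable_fun [set: unit_interval R]
    (fun r => (\d_(b, r) U : \bar R)).
  apply: (measurableT_comp (measurable_fun_dirac mU)).
  by apply: measurable_fun_pair.
apply: emeasurable_funD; apply: emeasurable_funM => //.
  exact/measurable_EFinP.
by apply/measurable_EFinP; exact: measurable_funB.
Qed.

HB.instance Definition _ :=
  isMeasurableFun.Build _ _ _ _ bern_fun measurable_bern.

Definition bern : coalgebra R (unit_interval R) := bern_fun.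

End bernoulli.

(* Main.v *)
Require Import Defs.
From HB Require Import structures.
From mathcomp Require Import all_boot all_order all_algebra.
From mathcomp Require Import all_classical all_reals all_analysis.
From mathcomp Require Import measurable_realfun giry.
From mathcomp Require Import ring lra zify.

(* Let [T_b phi x] be the integral of [phi] over the next state on the event that
   the output is [b]. Exchangeability says that [T_0] and [T_1] commute, so
   [c i j := T_0^i T_1^j 1 x] satisfies [c i j = c (i+1) j + c i (j+1)]. By the
   Hausdorff moment theorem there is a unique probability measure [f x] on [0, 1]
   with moments [c 0 n]. A channel [f] is a coalgebra map to [bern] if and only
   if its moments satisfy [m_(n+1) = T_1 m_n], that is, [m_n = c 0 n].

   Existence of the measure: [c] defines the law of the number [S_n] of ones
   among [n] outputs, and the moments of [S_n / n] converge to [c 0 j]. Let [G t]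
   be the limit of [P (S_n / n > t)] along an ultrafilter; the law of the
   quantile function of [G] under the uniform distribution is the wanted measure,
   since powers are uniformly approximated by staircase functions.

   Uniqueness, and measurability of [f]: the indicator of [x > t] is a bounded
   pointwise limit of polynomials on [0, 1]. *)

Set Implicit Arguments.
Unset Strict Implicit.
Unset Printing Implicit Defensive.
Import Order.TTheory GRing.Theory Num.Theory.
Import numFieldNormedType.Exports.

Local Open Scope classical_set_scope.
Local Open Scope ring_scope.

(** * Polynomial approximation of step functions *)

Lemma bernoulli_ineq (R : realFieldType) (w : R) m :
  -1 <= w -> 1 + m%:R * w <= (1 + w) ^+ m.
Proof.
move=> w1; elim: m => [|m IH]; first by rewrite mul0r addr0 expr0.
rewrite exprS; apply: (@le_trans _ _ ((1 + w) * (1 + m%:R * w))); last first.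
  by rewrite ler_wpM2l// addrC -lerBlDr sub0r.
rewrite -natr1; have := ler0n R m; nra.
Qed.

(** The upper bound combines [(1 - w)^m (1 + w)^m = (1 - w^2)^m <= 1] with
    [1 + m w <= (1 + w)^m]. *)
Lemma onem_expr_bounds (R : realFieldType) (w : R) m : 0 <= w <= 1 ->
  1 - m%:R * w <= (1 - w) ^+ m <= (1 + m%:R * w)^-1.
Proof.
move=> /andP[w0 w1]; apply/andP; split.
  by rewrite -mulrN; apply: bernoulli_ineq; lra.
have mw : 0 <= m%:R * w by rewrite mulr_ge0.
rewrite -[leRHS]mul1r ler_pdivlMr; last by lra.
apply: (@le_trans _ _ ((1 - w) ^+ m * (1 + w) ^+ m)).
  apply: ler_wpM2l; first by rewrite exprn_ge0// subr_ge0.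
  by apply: bernoulli_ineq; lra.
rewrite -exprMn exprn_ile1//; nra.
Qed.

(* With [z = 1 + x - t] and [N = (n+1)^2], the polynomial [1 - (1 - (a z / 2)^N)^(2^N)]
   lies between [1 - 1 / (1 + (a z)^N)] and [(a z)^N]. The factor [a < 1], which
   tends to 1 slowly enough, makes the limit 0 rather than [1 - 1/e] at [z = 1]. *)
Lemma step_poly (R : realType) (t : R) :
  exists p : nat -> {poly R}, forall x : R, 0 <= x <= 1 ->
    (forall n, 0 <= (p n).[x] <= 1) /\
    (p n).[x] @[n --> \oo] --> ((t < x)%R%:R : R).
Proof.
(* For [t] outside [[0, 1]] the step is constant on [[0, 1]]; otherwise [z] lies in [[0, 2]], which
   keeps [a z / 2] in [[0, 1]]. *)
have [t0|t0] := ltP t 0.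
  exists (fun=> 1) => x /andP[x0 x1]; rewrite (lt_le_trans t0 x0); split.
    by move=> n; rewrite hornerC ler01 lexx.
  by under eq_fun do rewrite hornerC; exact: cvg_cst.
have [t1|t1] := ltP 1 t.
  exists (fun=> 0) => x /andP[x0 x1]; rewrite ltNge (le_trans x1 (ltW t1))/=; split.
    by move=> n; rewrite hornerC ler01 lexx.
  by under eq_fun do rewrite hornerC; exact: cvg_cst.
pose a n : R := n.+1%:R / n.+2%:R.
pose N n := (n.+1 * n.+1)%N.
pose p n : {poly R} :=
  1 - (1 - ((a n / 2)%:P * ('X + (1 - t)%:P)) ^+ N n) ^+ (2 ^ N n).
exists p => x /andP[x0 x1].
pose z := 1 + x - t; have z0 : 0 <= z by rewrite /z; lra.
have z2 : z <= 2 by rewrite /z; lra.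
have a0 n : 0 < a n by rewrite divr_gt0// ltr0Sn.
have a1 n : a n <= 1 by rewrite ler_pdivrMr ?ltr0Sn// mul1r ler_nat.
pose w n := (a n / 2 * z) ^+ N n.
have pE n : (p n).[x] = 1 - (1 - w n) ^+ (2 ^ N n).
  by rewrite /p !(hornerE, horner_exp) /w /z/= (addrC x).
have w01 n : 0 <= w n <= 1.
  rewrite /w exprn_ge0 ?exprn_ile1 //; have := a0 n; have := a1 n; nra.
have mw n : (2 ^ N n)%:R * w n = (a n * z) ^+ N n.
  by rewrite natrX -exprMn; congr (_ ^+ _); field.
have pb n : 1 - (1 + (a n * z) ^+ N n)^-1 <= (p n).[x] <= (a n * z) ^+ N n.
  have := onem_expr_bounds (2 ^ N n) (w01 n); rewrite mw pE => /andP[? ?].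
  by apply/andP; split; lra.
have p01 n : 0 <= (p n).[x] <= 1.
  rewrite pE; have /andP[w0 w1] := w01 n.
  have h0 : 0 <= (1 - w n) ^+ (2 ^ N n) by rewrite exprn_ge0// subr_ge0.
  have h1 : (1 - w n) ^+ (2 ^ N n) <= 1.
    by rewrite exprn_ile1 ?subr_ge0// lerBlDr lerDl.
  by apply/andP; split; lra.
split => //.
have harm : (n.+2%:R^-1 : R) @[n --> \oo] --> (0 : R).
  by rewrite (cvg_shiftS (fun n => n.+1%:R^-1 : R)); exact: cvg_harmonic.
have [tx|xt] := ltP t x; last first.
  (* Here [z <= 1], and [a^-(n+1) = (1 + 1/(n+1))^(n+1) >= 2] gives [a^N <= 2^-(n+1) <= 1/(n+2)]. *)
  apply: (@squeeze_cvgr _ _ _ _ (cst 0) (fun n => n.+2%:R^-1)) => //; last exact: cvg_cst.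
  apply: nearW => n; have /andP[-> _] := p01 n.
  have /andP[_ h] := pb n; apply: (le_trans h).
  apply: (@le_trans _ _ (a n ^+ N n)).
    rewrite ler_pXn2r ?nnegrE ?mulr_ge0 ?(ltW (a0 n))//.
    rewrite ger_pMr// /z; lra.
  rewrite /N exprM -[leRHS]expr1.
  have aE : (a n)^-1 = 1 + n.+1%:R^-1.
    by rewrite invf_div -natr1 mulrDl divff ?mul1r// pnatr_eq0.
  rewrite -[leLHS]invrK expr1 lef_pV2 ?posrE ?invr_gt0 ?exprn_gt0 ?ltr0Sn//.
  have b : 2 <= (a n)^-1 ^+ n.+1.
    rewrite aE; apply: le_trans (bernoulli_ineq _ _); last first.
      by rewrite (@le_trans _ _ 0)// ?lerN10 // invr_ge0.
    by rewrite divff ?pnatr_eq0.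
  rewrite -!exprVn; apply: (@le_trans _ _ (2 ^+ n.+1)); last first.
    by rewrite ler_pXn2r ?nnegrE ?exprn_ge0 ?invr_ge0 ?(ltW (a0 n)).
  have := @bernoulli_ineq R 1 n.+1; rewrite -[n.+2%:R]natr1 mulr1.
  rewrite (_ : 1 + 1 = 2)// addrC; apply; lra.
have z1 : 1 < z by rewrite /z; lra.
(* The midpoint [1 + r] of 1 and [z] is eventually below [a z], as [a] tends to 1; then
   [(a z)^N >= N r >= (n+2) r]. *)
have [r0 zE] : 0 < (z - 1) / 2 /\ z = 1 + (z - 1) / 2 * 2.
  by split; [rewrite divr_gt0// subr_gt0|field].
set r := (z - 1) / 2 in r0 zE.
apply: (@squeeze_cvgr _ _ _ _ (fun n => 1 - r^-1 * n.+2%:R^-1) (cst 1)); first last.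
- exact: cvg_cst.
- rewrite -[X in _ --> X]subr0; apply: cvgB; first exact: cvg_cst.
  by rewrite -(mulr0 r^-1); apply: cvgMr.
have ar : \forall n \near \oo, 1 + r <= a n * z.
  have : (1 - n.+2%:R^-1 : R) @[n --> \oo] --> (1 : R).
    by rewrite -[X in _ --> X]subr0; apply: cvgB => //; exact: cvg_cst.
  move=> h; have : (1 + r) / z < 1 by rewrite ltr_pdivrMr; lra.
  move=> /(cvgr_gt _ h); apply: filterS => n /ltW.
  rewrite ler_pdivrMr; last by lra.
  have n2 : n.+2%:R != 0 :> R by rewrite pnatr_eq0.
  suff -> : a n = 1 - n.+2%:R^-1 by [].
  by apply: (mulIf n2); rewrite divfK// mulrBl mulVf// mul1r -[n.+2%:R]natr1 addrK.
near=> n.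
have /andP[_ ->] := p01 n; rewrite andbT.
have /andP[h _] := pb n; apply: le_trans h.
rewrite lerD2l lerN2 -invfM lef_pV2 ?posrE; last 2 first.
- by rewrite ltr_wpDr// exprn_ge0// mulr_ge0// ltW.
- by rewrite mulr_gt0// ltr0Sn.
apply: (@le_trans _ _ ((1 + r) ^+ N n)); last first.
  rewrite (@le_trans _ _ ((a n * z) ^+ N n))// ?lerDr//.
  rewrite ler_pXn2r ?nnegrE ?mulr_ge0 ?(ltW (a0 n))//; last lra.
  by near: n.
apply: le_trans (bernoulli_ineq _ _); last by lra.
rewrite mulrC (@le_trans _ _ ((N n)%:R * r))//; last by rewrite lerDr.
(* The inequality [n+2 <= (n+1)^2] fails at [n = 0]. *)
rewrite ler_pM2r// ler_nat; near: n; exists 1%N => // n /=; rewrite /N; nia.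
Unshelve. all: by end_near. Qed.

(** * Determinacy of moments *)

Section moments.
Context d (Y : measurableType d) (R : realType) (g : Y -> R) (D : set Y).
Hypotheses (mD : measurable D) (mg : measurable_fun [set: Y] g)
  (g01 : forall y, 0 <= g y <= 1).
Implicit Type mu : {finite_measure set Y -> \bar R}.

Lemma integrable_moment mu n : mu.-integrable D (fun y => (g y ^+ n)%:E).
Proof.
apply: measurable_bounded_integrable => //.
- by rewrite -ge0_fin_numE// fin_num_measure.
- exact/measurable_funX/measurable_funTS.
- exists 1; split => // x x1 y Dy /=; rewrite (le_trans _ (ltW x1))//.
  have /andP[g0 g1] := g01 y.
  by rewrite ger0_norm ?exprn_ge0// exprn_ile1.
Qed.

Lemma integral_horner mu (p : {poly R}) :
  (\int[mu]_(y in D) (p.[g y])%:E =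
   \sum_(i < size p) (p`_i)%:E * \int[mu]_(y in D) (g y ^+ i)%:E)%E.
Proof.
under eq_integral do rewrite horner_coef -sumEFin.
rewrite integral_sum//; last first.
  move=> i; under eq_fun do rewrite EFinM.
  by apply: integrableZl => //; exact: integrable_moment.
apply: eq_bigr => i _; under eq_integral do rewrite EFinM.
by rewrite integralZl//; exact: integrable_moment.
Qed.

(** Dominated convergence, with the constant 1 as bound, integrable because [mu] is finite. *)
Lemma cvg_integral_step_poly mu t (p : nat -> {poly R}) :
  (forall x : R, 0 <= x <= 1 -> (forall n, 0 <= (p n).[x] <= 1) /\
    (p n).[x] @[n --> \oo] --> ((t < x)%R%:R : R)) ->
  (\int[mu]_(y in D) ((p n).[g y])%:E @[n --> \oo] -->
    mu (D `&` [set y | t < g y]%R))%E.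
Proof.
move=> hp.
have mt : measurable [set y | t < g y].
  have := mg measurableT (measurable_itv `]t, +oo[); rewrite setTI.
  by congr (measurable _); apply/seteqP; split => y /=; rewrite in_itv/= andbT.
rewrite setIC -[X in _ --> X]integral_indic//.
apply: (@dominated_cvg _ _ _ mu _ mD _ _ (cst 1%E)) => //.
- move=> n; under eq_fun do rewrite horner_coef -sumEFin.
  apply: emeasurable_sum => i; apply/measurable_EFinP.
  by apply: measurable_funM => //; exact/measurable_funX/measurable_funTS.
- move=> y Dy; apply: cvg_EFin; first exact: nearW.
  by rewrite indicE mem_setE; have [_] := hp _ (g01 y).
- exact: finite_measure_integrable_cst.
- move=> n y Dy; have [/(_ n)/andP[p0 p1] _] := hp _ (g01 y).
  by rewrite lee_fin ger0_norm.
Qed.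

(** Integrals of polynomials in [g] are combinations of moments, so both measures of the ray are
    limits of the same sequence. *)
Lemma moments_determine (mu nu : {finite_measure set Y -> \bar R}) :
  (forall n, \int[mu]_(y in D) (g y ^+ n)%:E =
             \int[nu]_(y in D) (g y ^+ n)%:E)%E ->
  forall t, mu (D `&` [set y | t < g y]) = nu (D `&` [set y | t < g y]).
Proof.
move=> munu t; have [p hp] := step_poly t.
have := cvg_integral_step_poly (mu := nu) hp.
have := cvg_integral_step_poly (mu := mu) hp.
under eq_fun do rewrite integral_horner.
under [in X in _ -> X -> _]eq_fun do rewrite integral_horner.
under eq_fun do under eq_bigr do rewrite munu.
by move=> h1 h2; exact: (cvg_unique _ h1 h2).
Qed.

End moments.

(** * Measures on the unit interval *)

Section unit_interval.
Variable R : realType.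
Local Notation I := (unit_interval R).
Local Notation val := (@unit_interval_val R).

Lemma unit_interval_val01 (r : I) : 0 <= val r <= 1.
Proof. by case: r. Qed.

Definition unit_interval_rays : set (set I) :=
  [set A | exists t, A = [set r | t < val r]].

(** Preimages commute with generating a sigma-algebra, so the generators []t, +oo[] of the Borel
    sets can be pulled back along [val]. *)
Lemma measurable_unit_intervalE :
  measurable = <<s unit_interval_rays >>.
Proof.
transitivity (<<s setT, preimage_set_system setT val (@RGenOInfty.G R) >>).
  rewrite g_sigma_preimageE.
  transitivity (preimage_set_system setT val (@measurable _ R)) => //.
  by congr preimage_set_system; rewrite -RGenOInfty.measurableE.
congr (<<s setT, _ >>); apply/seteqP; split => A.
  by move=> [_ [t ->] <-]; exists t; rewrite setTI; apply/seteqP;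
    split => r /=; rewrite in_itv/= andbT.
by move=> [t ->]; exists `]t, +oo[%classic; [exists t|rewrite setTI; apply/seteqP;
    split => r /=; rewrite in_itv/= andbT].
Qed.

Lemma setI_closed_unit_interval_rays : setI_closed unit_interval_rays.
Proof.
move=> _ _ [s ->] [t ->]; exists (Num.max s t).
by apply/seteqP; split => r /=; rewrite gt_max => /andP.
Qed.

(** Dynkin induction from the rays. It serves with [D] a slice of [bool * I] and [g] the second
    projection, and with [D] full and [g] the identity. *)
Lemma moments_determine_preimage d (Y : measurableType d) (g : Y -> I)
    (D : set Y) (mu nu : {finite_measure set Y -> \bar R}) :
  measurable D -> measurable_fun [set: Y] g ->
  (forall n, \int[mu]_(y in D) (val (g y) ^+ n)%:E =
             \int[nu]_(y in D) (val (g y) ^+ n)%:E)%E ->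
  forall V, measurable V -> mu (D `&` g @^-1` V) = nu (D `&` g @^-1` V).
Proof.
move=> mD mg munu V; rewrite measurable_unit_intervalE.
have mgS W : measurable W -> measurable (g @^-1` W).
  by move=> mW; rewrite -[X in measurable X]setTI; exact: mg.
have rays t : mu (D `&` [set y | t < val (g y)]) = nu (D `&` [set y | t < val (g y)]).
  apply: moments_determine => //.
    by apply: measurableT_comp => //; exact: measurable_unit_interval_val.
  by move=> y; exact: unit_interval_val01.
(* The values of [val] are nonnegative, so the ray above -1 is everything. *)
have eqD : mu D = nu D.
  rewrite -[D]setIT (_ : setT = [set y | -1 < val (g y)]) ?rays//.
  apply/seteqP; split => // y _ /=.
  by have /andP[r0 _] := unit_interval_val01 (g y); rewrite (lt_le_trans _ r0)// ltrN10.
apply: (dynkin_induction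
  (P := fun W => mu (D `&` g @^-1` W) = nu (D `&` g @^-1` W))).
- exact: measurable_unit_intervalE.
- exact: setI_closed_unit_interval_rays.
- by rewrite preimage_setT setIT.
- by move=> _ [t ->]; exact: rays.
- move=> S mS munuS; rewrite preimage_setC -setDE.
  have mS' := mgS _ mS.
  have finD (m : {finite_measure set Y -> \bar R}) : (m D < +oo)%E.
    by rewrite -ge0_fin_numE// fin_num_measure.
  rewrite !measureD//; [|exact: finD|exact: finD].
  by congr (_ - _)%E; [exact: eqD|exact: munuS].
- move=> F mF tF munuF; rewrite preimage_bigcup setI_bigcupr.
  have tDF : trivIset setT (fun n => D `&` g @^-1` F n).
    by apply: trivIset_setIl => i k _ _ [y [Fi Fk]]; apply: tF => //; exists (g y).
  have mDF n : measurable (D `&` g @^-1` F n) by apply: measurableI => //; exact: mgS.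
  rewrite !measure_semi_bigcup//; try exact: bigcupT_measurable.
  by apply: eq_eseriesr => n _; exact: munuF.
Qed.

(** This makes a channel of measures chosen pointwise. On a ray, the measure is a limit of
    combinations of moments; Dynkin induction does the rest. *)
Lemma measurable_moments d (X : measurableType d)
    (f : X -> probability I R) :
  (forall n, measurable_fun [set: X]
    (fun x => \int[f x]_r (val r ^+ n)%:E)%E) ->
  forall U, measurable U -> measurable_fun [set: X] (fun x => f x U).
Proof.
move=> mf U; rewrite measurable_unit_intervalE.
apply: (dynkin_induction (P := fun U => measurable_fun [set: X] (fun x => f x U))).
- exact: measurable_unit_intervalE.
- exact: setI_closed_unit_interval_rays.
- by under eq_fun do rewrite probability_setT; exact: measurable_cst.
- move=> _ [t ->]; have [p hp] := step_poly t.
  apply: (emeasurable_fun_cvg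
    (fun n x => \int[f x]_r ((p n).[val r])%:E)%E) => [n|x _].
    under eq_fun do rewrite (integral_horner measurableT
      (@measurable_unit_interval_val R) unit_interval_val01).
    by apply: emeasurable_sum => i; exact: measurable_funeM.
  rewrite -[X in f x X]setTI.
  apply: (@cvg_integral_step_poly _ _ _ val setT measurableT) => //.
  - exact: measurable_unit_interval_val.
  - exact: unit_interval_val01.
- move=> S mS mfS; under eq_fun do rewrite probability_setC//.
  by apply: emeasurable_funB => //; exact: measurable_cst.
- move=> F mF tF mfF.
  have mU : measurable (\bigcup_k F k) by exact: bigcupT_measurable.
  under eq_fun do rewrite (measure_semi_bigcup _ mF tF mU).
  by apply: (ge0_emeasurable_sum (h := fun k x => f x (F k)) (P := xpredT)).
Qed.

End unit_interval.

(** * The Hausdorff moment theorem *)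

Section completely_monotone.
Variable R : realType.
Implicit Types (c : nat -> nat -> R) (phi : R -> R).

(** The recurrence makes [c i j] the [i]-th difference of the sequence [c 0], up to the sign
    [(-1)^i]: this is Hausdorff's condition on that sequence. *)
Definition completely_monotone c :=
  (forall i j, 0 <= c i j) /\ (forall i j, c i j = c i.+1 j + c i j.+1).

(** The weights of the words that continue a first output 1. *)
Definition shift c i j := c i j.+1.

Lemma completely_monotone_shift c :
  completely_monotone c -> completely_monotone (shift c).
Proof. by move=> [c0 cE]; split => i j; [exact: c0|exact: cE]. Qed.

(* The mean of [phi (S_n / n)], when [c (n - k) k] is the probability of each
   word of length [n] with [k] ones. *)
Definition freq_mean c n phi : R :=
  \sum_(k < n.+1) 'C(n, k)%:R * c (n - k)%N k * phi (k%:R / n%:R).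

(** Pascal's rule splits the words by one letter; the two halves are the induction hypothesis for
    [c i.+1 j] and for [shift c]. *)
Lemma freq_mean_cst c n : completely_monotone c ->
  \sum_(k < n.+1) 'C(n, k)%:R * c (n - k)%N k = c 0%N 0%N.
Proof.
elim: n c => [|n IH] c [c0 cE].   by rewrite big_ord1 bin0 mul1r.
have IH1 := IH (shift c) (completely_monotone_shift (conj c0 cE)).
have IH2 : \sum_(k < n.+1) 'C(n, k)%:R * c (n - k).+1%N k = c 1%N 0%N.
  by apply: (IH (fun i j => c i.+1 j)); split => i j; [exact: c0|exact: cE].
rewrite cE -IH2 -[X in _ + X]IH1 big_ord_recl/= bin0 subn0 mul1r.
under eq_bigr do rewrite /bump/= add1n binS natrD mulrDl subSS.
rewrite big_split/= addrA; congr (_ + _).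
rewrite big_ord_recr/= bin_small// mul0r addr0.
rewrite [RHS]big_ord_recl/= bin0 subn0 mul1r; congr (_ + _).
by apply: eq_bigr => k _; rewrite /bump/= add1n subnSK.
Qed.

(** The factor [s] kills the term [k = 0], and [(k+1)/(n+1)] turns ['C(n+1, k+1)] into
    ['C(n, k)]. *)
Lemma freq_mean_mulX c n phi :
  freq_mean c n.+1 (fun s => s * phi s) =
  \sum_(k < n.+1) 'C(n, k)%:R * shift c (n - k)%N k * phi (k.+1%:R / n.+1%:R).
Proof.
rewrite /freq_mean big_ord_recl/= !mul0r mulr0 add0r; apply: eq_bigr => k _.
rewrite /bump/= add1n subSS [in RHS]/shift.
have -> : 'C(n, k)%:R = 'C(n.+1, k.+1)%:R * (k.+1%:R / n.+1%:R) :> R.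
  by rewrite mulrA -natrM mulnC -mul_bin_diag natrM mulrC mulKf// pnatr_eq0.
ring.
Qed.

Lemma ler_norm_subXX (a b : R) n : 0 <= a <= 1 -> 0 <= b <= 1 ->
  `|a ^+ n - b ^+ n| <= n%:R * `|a - b|.
Proof.
move=> a01 b01; elim: n => [|n IH]; first by rewrite subrr normr0 mul0r.
have -> : a ^+ n.+1 - b ^+ n.+1 = a * (a ^+ n - b ^+ n) + (a - b) * b ^+ n.
  by rewrite !exprS; ring.
rewrite (le_trans (ler_normD _ _))// -[n.+1%:R]natr1 [leRHS]mulrDl mul1r lerD// normrM.
  rewrite (le_trans _ IH)// ler_piMl// ger0_norm; lra.
by rewrite ler_piMr// ger0_norm ?exprn_ge0 ?exprn_ile1//; lra.
Qed.

(** By [freq_mean_mulX], the moment [j+1] for [c] and the moment [j] for [shift c] differ only in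
    the evaluation points [(k+1)/(n+1)] and [k/n]. *)
Lemma cvg_freq_mean_moment c j : completely_monotone c ->
  freq_mean c n (fun s => s ^+ j) @[n --> \oo] --> c 0%N j.
Proof.
elim: j c => [|j IH] c cm.
  rewrite (_ : (fun n => _) = fun=> c 0%N 0%N); first exact: cvg_cst.
  apply/funext => n; rewrite -(freq_mean_cst n cm); apply: eq_bigr => k _.
  by rewrite expr0 mulr1.
have cm' := completely_monotone_shift cm.
rewrite -cvg_shiftS /=.
(* The Lipschitz constant [j] of the power, times the total mass [c 0 1] of [shift c], times the
   bound [1/(n+1)] on the distance of the evaluation points. *)
pose err n : R := j%:R * c 0%N 1%N * n.+1%:R^-1.
have err0 : err n @[n --> \oo] --> (0 : R).
  by rewrite -(mulr0 (j%:R * c 0%N 1%N)); apply: cvgMr; exact: cvg_harmonic.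
have h n : `|freq_mean (shift c) n (fun s => s ^+ j) -
    freq_mean c n.+1 (fun s => s ^+ j.+1)| <= err n.
  have -> : freq_mean c n.+1 (fun s => s ^+ j.+1) =
      freq_mean c n.+1 (fun s => s * s ^+ j).
    by apply: eq_bigr => k _; rewrite exprS.
  rewrite freq_mean_mulX /freq_mean -sumrB (le_trans (ler_norm_sum _ _ _))//.
  rewrite /err -[c 0%N 1%N]/(shift c 0%N 0%N) -(freq_mean_cst n cm') mulr_sumr mulr_suml.
  apply: ler_sum => k _; rewrite -mulrBr normrM ger0_norm; last first.
    by rewrite mulr_ge0//; case: cm' => + _; exact.
  rewrite [leRHS]mulrAC [leRHS]mulrC ler_wpM2l//.
    by rewrite mulr_ge0//; case: cm' => + _; exact.
  have kn : (k <= n)%N by rewrite -ltnS.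
  (* At [n = 0] the quotient is 0 by convention. *)
  have k01 : 0 <= (k%:R / n%:R : R) <= 1.
    rewrite divr_ge0//=; case: n k kn {IH} => [|n] k kn.
      by rewrite invr0 mulr0.
    by rewrite ler_pdivrMr ?ltr0Sn// mul1r ler_nat.
  have k01' : 0 <= (k.+1%:R / n.+1%:R : R) <= 1.
    by rewrite divr_ge0//= ler_pdivrMr ?ltr0Sn// mul1r ler_nat.
  rewrite (le_trans (ler_norm_subXX _ k01 k01'))// ler_wpM2l//.
  rewrite distrC ler_norml; case: n k kn {IH k01 k01'} => [|n] k kn.
    by move: kn; rewrite leqn0 => /eqP ->; rewrite mul0r subr0 divr1 invr1; lra.
  have n1 : n.+1%:R != 0 :> R by rewrite pnatr_eq0.
  have n2 : n.+2%:R != 0 :> R by rewrite pnatr_eq0.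
  have -> : k.+1%:R / n.+2%:R - k%:R / n.+1%:R =
      (n.+1%:R - k%:R) / n.+1%:R * n.+2%:R^-1 :> R.
    move: n1 n2; rewrite -[n.+2%:R]natr1 -[k.+1%:R]natr1 => n1 n2.
    by field; rewrite nat1r natr1 !pnatr_eq0.
  have i0 : 0 <= (n.+2%:R^-1 : R) by rewrite invr_ge0.
  have : 0 <= ((n.+1%:R - k%:R) / n.+1%:R : R) <= 1.
    rewrite divr_ge0 ?subr_ge0 ?ler_nat//= ler_pdivrMr ?ltr0Sn// mul1r.
    by rewrite lerBlDr lerDl.
  move: (_ / n.+1%:R) (n.+2%:R^-1) i0 => y i i0 /andP[? ?].
  by apply/andP; split; nra.
rewrite -[c 0%N j.+1]/(shift c 0%N j) -[shift c 0%N j]subr0.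
rewrite (_ : (fun n => _) = (fun n => freq_mean (shift c) n (fun s => s ^+ j) -
   (freq_mean (shift c) n (fun s => s ^+ j) -
    freq_mean c n.+1 (fun s => s ^+ j.+1)))); last first.
  by apply/funext => n; rewrite subKr.
apply: cvgB; first exact: IH.
apply/norm_cvg0P; apply: (@squeeze_cvgr _ _ _ _ (cst 0) err) => //.
  by apply: nearW => n; rewrite normr_ge0 h.
exact: cvg_cst.
Qed.

Lemma ler_freq_mean c n phi psi : completely_monotone c ->
  (forall s, 0 <= s <= 1 -> phi s <= psi s) ->
  freq_mean c n phi <= freq_mean c n psi.
Proof.
move=> [c0 _] h; apply: ler_sum => k _; rewrite ler_wpM2l ?mulr_ge0//.
apply: h; rewrite divr_ge0//=; have kn : (k <= n)%N by rewrite -ltnS.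
case: n k kn => [|n] k kn; first by rewrite invr0 mulr0.
by rewrite ler_pdivrMr ?ltr0Sn// mul1r ler_nat.
Qed.

End completely_monotone.

(** The image of an ultrafilter is an ultrafilter, and [[0, 1]] is compact. One ultrafilter thus
    gives limits for all thresholds [t] at once, without extracting subsequences. *)
Lemma ultra_cvg01 (R : realType) (F : set_system nat) (u : nat -> R) :
  UltraFilter F -> (forall n, 0 <= u n <= 1) ->
  exists l : R, 0 <= l <= 1 /\ u @ F --> l.
Proof.
move=> FU u01.
have uFU : UltraFilter (u @ F).
  split; first exact: fmap_proper_filter.
  move=> G GF FG; apply/seteqP; split => // A GA.
  have [//|FnA] := in_ultra_setVsetC (u @^-1` A) FU.
  have /filterI/(_ GA) : G (~` A) by exact: FG.
  by rewrite setICl => /filter_not_empty.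
have := @segment_compact R 0 1; rewrite compact_ultra => /(_ _ uFU)[].
  by apply: (@filterE _ F) => n; rewrite /= in_itv/=; exact: u01.
by move=> l [/=]; rewrite in_itv/= => l01 ul; exists l.
Qed.

(** * Staircase approximation of powers *)

Section staircase.
Variables (R : realType) (N j : nat).
Hypothesis N0 : (0 < N)%N.

(** The height of the step at [i/N]. The exponent is positive so that the staircase starts from the
    value 0. *)
Definition stair (i : nat) : R := (i.+1%:R / N%:R) ^+ j.+1 - (i%:R / N%:R) ^+ j.+1.

Lemma stair_ge0 i : 0 <= stair i.
Proof.
rewrite subr_ge0 ler_pXn2r ?nnegrE ?divr_ge0//.
by rewrite ler_wpM2r ?invr_ge0// ler_nat.
Qed.

Lemma le_staircase (s : R) : 0 <= s <= 1 ->
  s ^+ j.+1 <= \sum_(i < N) stair i * (i%:R / N%:R < s)%R%:R.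
Proof.
move=> /andP[s0 s1].
have N0' : 0 < (N%:R : R) by rewrite ltr0n.
(* Induction on the number of steps, with the power capped at the last grid point reached; at
   [M = N] the cap has no effect since [s <= 1]. *)
suff h M : (Num.min s (M%:R / N%:R)) ^+ j.+1 <=
    \sum_(i < M) stair i * (i%:R / N%:R < s)%R%:R.
  by have := h N; rewrite divff ?gt_eqF// min_l.
elim: M => [|M IH].
  by rewrite big_ord0 mul0r min_r// expr0n.
rewrite big_ord_recr/=; have [Ms|sM] := ltP (M%:R / N%:R) s; last first.
  rewrite mulr0 addr0 (le_trans _ IH)// !min_l//.
  by rewrite (le_trans sM)// ler_wpM2r ?invr_ge0// ler_nat.
move: IH; rewrite (min_r (ltW Ms)) mulr1 => IH.
apply: (@le_trans _ _ ((M.+1%:R / N%:R) ^+ j.+1)).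
  rewrite ler_pXn2r ?nnegrE ?le_min ?s0 ?divr_ge0//.
  by rewrite ge_min lexx orbT.
by rewrite -lerBlDr /stair opprB addrC subrK.
Qed.

(** The steps up to [s] telescope to a power of at most [s + 1/N]. The comparison [<=] here and [<]
    in [le_staircase] match the two sides of [exists_probability_tail]. *)
Lemma staircase_le (s : R) : 0 <= s <= 1 ->
  \sum_(i < N) stair i * (i%:R / N%:R <= s)%R%:R <= s ^+ j.+1 + 3 ^+ j.+1 / N%:R.
Proof.
move=> /andP[s0 s1].
have N0' : 0 < (N%:R : R) by rewrite ltr0n.
apply: (@le_trans _ _ ((s + N%:R^-1) ^+ j.+1)).
  suff h M : \sum_(i < M) stair i * (i%:R / N%:R <= s)%R%:R <=
      (M%:R / N%:R) ^+ j.+1 /\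
    \sum_(i < M) stair i * (i%:R / N%:R <= s)%R%:R <= (s + N%:R^-1) ^+ j.+1.
    by have [] := h N.
  elim: M => [|M [IH1 IH2]].
    by rewrite big_ord0 exprn_ge0 ?divr_ge0// exprn_ge0// addr_ge0 ?invr_ge0.
  rewrite big_ord_recr/=.
  have step : (M%:R / N%:R) ^+ j.+1 + stair M = (M.+1%:R / N%:R) ^+ j.+1.
    by rewrite /stair addrC subrK.
  have [Ms|sM] := leP (M%:R / N%:R) s; last first.
    by rewrite mulr0 addr0; split => //; rewrite (le_trans IH1)// -step lerDl stair_ge0.
  rewrite mulr1; split; first by rewrite -step lerD2r.
  apply: (@le_trans _ _ ((M.+1%:R / N%:R) ^+ j.+1)); first by rewrite -step lerD2r.
  rewrite ler_pXn2r ?nnegrE ?divr_ge0 ?addr_ge0 ?invr_ge0//.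
  by rewrite -natr1 mulrDl mul1r lerD2r.
set e := N%:R^-1.
have e0 : 0 <= e by rewrite invr_ge0.
have e1 : e <= 1 by rewrite invf_le1// ler1n.
(* The base 3 works because multiplying by [s + e <= 2] at most doubles the error [3^m e] and adds
   [e s^m <= 3^m e]. *)
elim: (j.+1) => [|m IH]; first by rewrite !expr0; lra.
rewrite !exprS; have sm0 : 0 <= s ^+ m by rewrite exprn_ge0.
have sm1 : s ^+ m <= 1 by rewrite exprn_ile1.
have t1 : 1 <= (3 : R) ^+ m by rewrite exprn_ege1//; lra.
have : (s + e) * (s + e) ^+ m <= (s + e) * (s ^+ m + 3 ^+ m * e).
  by rewrite ler_wpM2l// addr_ge0.
move=> /le_trans; apply.
have : e * s ^+ m <= e * 3 ^+ m by rewrite ler_wpM2l// (le_trans sm1).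
have : (s + e) * (3 ^+ m * e) <= 2 * (3 ^+ m * e).
  by rewrite ler_wpM2r ?mulr_ge0//; lra.
nra.
Qed.

End staircase.

Lemma uniform_prob01_lt (R : realType) (a : R) : 0 <= a <= 1 ->
  uniform_prob (@ltr01 R) [set u | u < a] = a%:E.
Proof.
move=> /andP[a0 a1].
have ma : measurable [set u : R | u < a].
  rewrite (_ : mkset _ = `]-oo, a[%classic); first exact: measurable_itv.
  by apply/seteqP; split => u /=; rewrite in_itv.
rewrite -[X in uniform_prob _ X]setIT -integral_indic// integral_uniform//.
  rewrite integral_indic// subr0 invr1 mul1e.
  rewrite (_ : _ `&` _ = `[0, a[%classic); last first.
    apply/seteqP; split => u /=; rewrite !in_itv/=.
      by move=> [-> /andP[->]].
    by move=> /andP[-> ua]; rewrite ua (le_trans (ltW ua)).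
  rewrite /= lebesgue_measure_itv/= lte_fin; case: ltP => [_|a0'].
    by rewrite oppr0 adde0.
  by congr EFin; apply/le_anti; rewrite a0 a0'.
exact/measurable_EFinP/measurable_indic.
Qed.

(** * Measures with a prescribed tail, by quantiles *)

Section quantile.
Variables (R : realType) (G : R -> R).
Hypotheses (G01 : forall t, 0 <= G t <= 1)
  (G_ni : forall s t, s <= t -> G t <= G s).

(** The point 0 keeps the set nonempty when [u < G t] holds for no [t] in [[0, 1]]. *)
Let S u : set R := [set t | 0 <= t <= 1 /\ (t = 0 \/ u < G t)].

Let S_sup u : has_sup (S u).
Proof.
split; first by exists 0; split; [rewrite lexx ler01|left].
by exists 1 => t [/andP[]].
Qed.

Definition quantile u : R := sup (S u).

Lemma quantile01 u : 0 <= quantile u <= 1.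
Proof.
apply/andP; split.
  by apply: sup_upper_bound => //; split; [rewrite lexx ler01|left].
by apply: ge_sup; [by case: (S_sup u)|move=> t [/andP[]]].
Qed.

Lemma quantile_gt u t : 0 <= t -> t < quantile u -> u < G t.
Proof.
move=> t0 /sup_gt[|s [_ [->|us]] ts]; first by case: (S_sup u).
  by move: ts; rewrite ltNge t0.
by rewrite (lt_le_trans us)// G_ni// ltW.
Qed.

Lemma quantile_ge u t : 0 <= t <= 1 -> u < G t -> t <= quantile u.
Proof. by move=> t01 ut; apply: sup_upper_bound => //; split => //; right. Qed.

Lemma quantile_nonincreasing u v : u <= v -> quantile v <= quantile u.
Proof.
move=> uv; apply: ge_sup; first by case: (S_sup v).
move=> t [t01 [->|vt]]; first by have /andP[] := quantile01 u.
by apply: quantile_ge => //; exact: le_lt_trans vt.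
Qed.

Definition quantile_fun (u : measurableTypeR R) : unit_interval R :=
  exist _ (quantile u) (quantile01 u).

Let measurable_quantile_fun : measurable_fun [set: measurableTypeR R] quantile_fun.
Proof.
have mq : measurable_fun [set: R] quantile.
  by apply: nonincreasing_measurable => // u v; exact: quantile_nonincreasing.
by move=> _ _ [B mB <-]; rewrite setTI; exact: mq.
Qed.

HB.instance Definition _ :=
  isMeasurableFun.Build _ _ _ _ quantile_fun measurable_quantile_fun.

(** Under the uniform law, the event [u < G t] has probability [G t] and lies between
    [t < quantile u] and [t <= quantile u]. One-sided continuity of [G] is not assumed, hence two
    bounds instead of an equality. *)
Lemma exists_probability_tail : exists mu : probability (unit_interval R) R,
  forall t : R, 0 <= t <= 1 ->
    (mu [set r | (t < unit_interval_val r)%R] <= (G t)%:E <=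
     mu [set r | (t <= unit_interval_val r)%R])%E.
Proof.
exists (distribution (uniform_prob (@ltr01 R)) quantile_fun) => t t01.
have mG : measurable [set u : R | u < G t].
  rewrite (_ : mkset _ = `]-oo, G t[%classic); first exact: measurable_itv.
  by apply/seteqP; split => u /=; rewrite in_itv.
have mge : measurable (quantile_fun @^-1` [set r | t <= unit_interval_val r]).
  rewrite -[X in measurable X]setTI; apply: measurable_quantile_fun => //.
  exists `[t, +oo[%classic => //.
  by rewrite setTI; apply/seteqP; split => r /=; rewrite in_itv/= andbT.
have mgt : measurable (quantile_fun @^-1` [set r | t < unit_interval_val r]).
  rewrite -[X in measurable X]setTI; apply: measurable_quantile_fun => //.
  exists `]t, +oo[%classic => //.
  by rewrite setTI; apply/seteqP; split => r /=; rewrite in_itv/= andbT.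
rewrite -(uniform_prob01_lt (G01 t)); apply/andP; split.
  rewrite /distribution /pushforward.
  apply: (le_measure (uniform_prob (@ltr01 R))); rewrite ?inE// => u /=.
  by apply: quantile_gt; case/andP: t01.
rewrite /distribution /pushforward.
apply: (le_measure (uniform_prob (@ltr01 R))); rewrite ?inE// => u /=.
exact: quantile_ge.
Qed.

End quantile.

(** * Existence of a measure with moments [c 0 n] *)

Section hausdorff.
Variables (R : realType) (c : nat -> nat -> R).
Hypotheses (cm : completely_monotone c) (c1 : c 0%N 0%N = 1).

Let gt_ind (t s : R) : R := (t < s)%R%:R.

(** Each tail is at most the total mass [c 0 0 = 1], so [ultra_cvg01] applies for every [t]. *)
Let exists_limit_tail (F : set_system nat) : UltraFilter F ->
  exists G : R -> R, (forall t, 0 <= G t <= 1) /\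
    forall t, freq_mean c n (gt_ind t) @[n --> F] --> G t.
Proof.
move=> FU.
have h t : exists l : R, 0 <= l <= 1 /\ freq_mean c n (gt_ind t) @[n --> F] --> l.
  apply: ultra_cvg01 => n; apply/andP; split.
    by apply: sumr_ge0 => k _; rewrite !mulr_ge0//; case: cm.
  rewrite -c1 -(freq_mean_cst n cm); apply: ler_sum => k _.
  rewrite ler_piMr ?mulr_ge0//; last by rewrite /gt_ind; case: ltP.
  by case: cm.
by have [G hG] := choice h; exists G; split => t; have [] := hG t.
Qed.

Let freq_mean_stair n N j : freq_mean c n
    (fun s => \sum_(i < N) stair R N j i * gt_ind (i%:R / N%:R) s) =
  \sum_(i < N) stair R N j i * freq_mean c n (gt_ind (i%:R / N%:R)).
Proof.
rewrite /freq_mean; under eq_bigr do rewrite mulr_sumr.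
rewrite exchange_big/=; apply: eq_bigr => i _; rewrite mulr_sumr.
by apply: eq_bigr => k _; ring.
Qed.

(** The two staircase inequalities are averaged by [freq_mean] and passed to the limit along [F]. *)
Lemma stair_limit_bounds (F : set_system nat) (G : R -> R) N j :
    ProperFilter F -> F `=>` \oo ->
    (forall t, freq_mean c n (gt_ind t) @[n --> F] --> G t) -> (0 < N)%N ->
  c 0%N j.+1 <= \sum_(i < N) stair R N j i * G (i%:R / N%:R)
    <= c 0%N j.+1 + 3 ^+ j.+1 / N%:R.
Proof.
move=> PF Foo EG N0.
have mean j' : freq_mean c n (fun s => s ^+ j') @[n --> F] --> c 0%N j'.
  by move=> A /(cvg_freq_mean_moment (j := j') cm) /Foo.
have stairs : \sum_(i < N) stair R N j i * freq_mean c n (gt_ind (i%:R / N%:R))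
    @[n --> F] --> \sum_(i < N) stair R N j i * G (i%:R / N%:R).
  apply: cvg_big => [|i _]; first exact: add_continuous.
  by apply: cvgMr; exact: EG.
apply/andP; split.
  apply: (ler_cvg_to (mean j.+1) stairs); apply: nearW => n.
  rewrite -freq_mean_stair; apply: ler_freq_mean => // s s01.
  exact: le_staircase.
have e0 : freq_mean c n (fun s => s ^+ j.+1) + 3 ^+ j.+1 / N%:R @[n --> F] -->
    c 0%N j.+1 + 3 ^+ j.+1 / N%:R.
  by apply: cvgD; [exact: mean|exact: cvg_cst].
apply: (ler_cvg_to stairs e0); apply: nearW => n.
(* A constant moves under the mean because the total mass is 1. *)
have -> : freq_mean c n (fun s => s ^+ j.+1) + 3 ^+ j.+1 / N%:R =
    freq_mean c n (fun s => s ^+ j.+1 + 3 ^+ j.+1 / N%:R).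
  rewrite -[X in _ + X]mulr1 -[X in _ * X]c1 -(freq_mean_cst n cm) mulr_sumr.
  rewrite -big_split; apply: eq_bigr => k _ /=; ring.
rewrite -freq_mean_stair; apply: ler_freq_mean => // s s01.
apply: le_trans (staircase_le _ N0 s01); apply: ler_sum => i _.
rewrite ler_wpM2l ?stair_ge0// /gt_ind ler_nat.
by case: (ltP _ s) => [/ltW ->|].
Qed.

Local Notation val := (@unit_interval_val R).

(** The bounds of [stair_limit_bounds] with the moment of [mu] in place of [c 0 j.+1], obtained by
    integrating the staircase inequalities. *)
Lemma stair_moment_bounds (mu : probability (unit_interval R) R) (G : R -> R) N j :
    (forall t : R, 0 <= t <= 1 ->
      (mu [set r | (t < val r)%R] <= (G t)%:E <= mu [set r | (t <= val r)%R])%E) ->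
    (0 < N)%N ->
  (\int[mu]_r (val r ^+ j.+1)%:E <=
     (\sum_(i < N) stair R N j i * G (i%:R / N%:R))%:E <=
   \int[mu]_r (val r ^+ j.+1)%:E + (3 ^+ j.+1 / N%:R)%:E)%E.
Proof.
move=> muG N0.
have mval := @measurable_unit_interval_val R.
have iN01 (i : 'I_N) : 0 <= (i%:R / N%:R : R) <= 1.
  by rewrite divr_ge0//= ler_pdivrMr ?ltr0n// mul1r ler_nat ltnW.
have mgt t : measurable [set r | t < val r].
  by rewrite measurable_unit_intervalE; apply: sub_sigma_algebra; exists t.
have mge t : measurable [set r | t <= val r].
  exists `[t, +oo[%classic => //.
  by rewrite setTI; apply/seteqP; split => r /=; rewrite in_itv/= andbT.
(* The family [A] is instantiated with open rays for the lower bound and closed rays for the upper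
   one. *)
have stairE (A : R -> set (unit_interval R)) : (forall t, measurable (A t)) ->
    (\int[mu]_r (\sum_(i < N) stair R N j i * \1_(A (i%:R / N%:R)) r)%:E =
     \sum_(i < N) (stair R N j i)%:E * mu (A (i%:R / N%:R)%R))%E.
  move=> mA; under eq_integral do rewrite -sumEFin.
  rewrite ge0_integral_sum//; first last.
  - by move=> i r _; rewrite lee_fin mulr_ge0 ?stair_ge0.
  - by move=> i; apply/measurable_EFinP/measurable_funM.
  apply: eq_bigr => i _; under eq_integral do rewrite EFinM.
  rewrite ge0_integralZl//.
  - by rewrite integral_indic// setIT.
  - exact/measurable_EFinP.
  - by rewrite lee_fin stair_ge0.
have mstair (A : R -> set (unit_interval R)) : (forall t, measurable (A t)) ->
    measurable_fun [set: unit_interval R] (fun r =>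
      (\sum_(i < N) stair R N j i * \1_(A (i%:R / N%:R)) r)%:E).
  move=> mA; apply/measurable_EFinP; apply: measurable_sum => i.
  exact: measurable_funM.
have stair0 (A : R -> set (unit_interval R)) r :
    (0 <= (\sum_(i < N) stair R N j i * \1_(A (i%:R / N%:R)) r)%:E)%E.
  by rewrite lee_fin sumr_ge0// => i _; rewrite mulr_ge0 ?stair_ge0.
have mX : measurable_fun [set: unit_interval R] (fun r => (val r ^+ j.+1)%:E).
  exact/measurable_EFinP/measurable_funX.
rewrite -sumEFin; under eq_bigr do rewrite EFinM.
apply/andP; split.
  apply: (@le_trans _ _ (\sum_(i < N) (stair R N j i)%:E *
      mu [set r | (i%:R / N%:R < val r)%R])%E); last first.
    apply: lee_sum => i _; rewrite lee_wpmul2l ?lee_fin ?stair_ge0//.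
    by have /andP[] := muG _ (iN01 i).
  rewrite -(stairE (fun t => [set r | t < val r]))//; apply: ge0_le_integral => //.
  - by move=> r _; rewrite lee_fin exprn_ge0//; case/andP: (unit_interval_val01 r).
  - exact: (mstair (fun t => [set r | t < val r])).
  - move=> r _; rewrite lee_fin; under eq_bigr do rewrite indicE mem_setE.
    by apply: le_staircase => //; exact: unit_interval_val01.
apply: (@le_trans _ _ (\sum_(i < N) (stair R N j i)%:E *
    mu [set r | (i%:R / N%:R <= val r)%R])%E).
  apply: lee_sum => i _; rewrite lee_wpmul2l ?lee_fin ?stair_ge0//.
  by have /andP[] := muG _ (iN01 i).
rewrite -(stairE (fun t => [set r | t <= val r]))//.
have e0 : 0 <= 3 ^+ j.+1 / N%:R :> R by rewrite divr_ge0// exprn_ge0.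
rewrite [X in (_ <= _ + X)%E](_ : _ = \int[mu]_r (3 ^+ j.+1 / N%:R)%:E)%E; last first.
  by rewrite integral_cst//= (@probability_setT _ _ _ mu) mule1.
rewrite -ge0_integralD//; last first.
  by move=> r _; rewrite lee_fin exprn_ge0//; case/andP: (unit_interval_val01 r).
apply: ge0_le_integral => //.
- by move=> r _; exact: (stair0 (fun t => [set r | t <= val r])).
- exact: (mstair (fun t => [set r | t <= val r])).
- exact: emeasurable_funD.
- move=> r _; rewrite -EFinD lee_fin; under eq_bigr do rewrite indicE mem_setE.
  by apply: staircase_le => //; exact: unit_interval_val01.
Qed.

Lemma hausdorff_moment : exists mu : probability (unit_interval R) R,
  forall n, (\int[mu]_r (val r ^+ n)%:E)%E = (c 0%N n)%:E.
Proof.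
have [F [FU Foo]] := ultraFilterLemma (@eventually_filter).
have [G [G01 EG]] := exists_limit_tail FU.
have G_ni s t : s <= t -> G t <= G s.
  move=> st; apply: (ler_cvg_to (EG t) (EG s)); apply: nearW => n.
  apply: ler_freq_mean => // r _; rewrite /gt_ind ler_nat.
  by case: (ltP t r) => // tr; rewrite (le_lt_trans st tr).
have [mu muG] := exists_probability_tail G01 G_ni.
(* The staircases treat positive exponents only; the moment of order 0 is the total mass. *)
exists mu => -[|j].
  under eq_integral do rewrite expr0.
  by rewrite integral_cst//= (@probability_setT _ _ _ mu) mul1e c1.
have mfin : (\int[mu]_r (val r ^+ j.+1)%:E)%E \is a fin_num.
  apply: integrable_fin_num => //; apply: integrable_moment => //.
    exact: measurable_unit_interval_val.
  exact: unit_interval_val01.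
rewrite -(fineK mfin); congr EFin; set M := fine _.
(* Both numbers lie below the same staircase sum, by at most [3^(j+1) / N]. *)
have bounds N : (0 < N)%N -> `|M - c 0%N j.+1| <= 3 ^+ j.+1 / N%:R.
  move=> N0; have /andP[] := stair_moment_bounds j muG N0.
  rewrite -(fineK mfin) -EFinD !lee_fin -/M => h1 h2.
  have /andP[h3 h4] := stair_limit_bounds j (@ultra_proper _ _ FU) Foo EG N0.
  by rewrite ler_norml; apply/andP; split; lra.
apply/eqP; rewrite -subr_eq0 -normr_eq0 eq_le normr_ge0 andbT.
apply/ler_addgt0Pr => e e0; rewrite add0r.
have t0 : 0 <= (3 : R) ^+ j.+1 by rewrite exprn_ge0.
have := archi_boundP (divr_ge0 t0 (ltW e0)); set N := Num.bound _ => hN.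
have N0 : (0 < N)%N.
  by rewrite -(ltr_nat R) (le_lt_trans _ hN)// divr_ge0// ltW.
rewrite (le_trans (bounds N N0))// ler_pdivrMr ?ltr0n// mulrC -ler_pdivrMr//.
exact: ltW.
Qed.

End hausdorff.

(** * Channels and coalgebras *)

Section channel_integrals.
Local Open Scope ereal_scope.
Variable R : realType.

Lemma eq_channel_integral d d' (X : measurableType d) (Y : measurableType d')
    (f g : channel R X Y) (x : X) (phi : Y -> \bar R) : channel_eq f g ->
  \int[(f x : probability Y R)]_y phi y = \int[(g x : probability Y R)]_y phi y.
Proof. by move=> fg; apply: eq_measure_integral => A mA _; exact: fg. Qed.

Lemma measurable_channel_integral d d' (X : measurableType d)
    (Y : measurableType d') (f : channel R X Y) (phi : Y -> \bar R) :
  (forall y, 0 <= phi y) -> measurable_fun [set: Y] phi ->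
  measurable_fun [set: X] (fun x => \int[(f x : probability Y R)]_y phi y).
Proof.
move=> phi0 mphi.
apply: (@measurable_fun_integral_kernel _ _ _ _ _
  (fun x => (f x : probability Y R) : {measure set Y -> \bar R})) => // U mU.
exact: measurable_channel_ev.
Qed.

Lemma integral_kleisli d1 d2 d3 (X : measurableType d1) (Y : measurableType d2)
    (Z : measurableType d3) (g : channel R Y Z) (f : channel R X Y) (x : X)
    (phi : Z -> \bar R) :
  (forall z, 0 <= phi z) -> measurable_fun [set: Z] phi ->
  \int[(kleisli g f x : probability Z R)]_z phi z =
  \int[(f x : probability Y R)]_y \int[(g y : probability Z R)]_z phi z.
Proof.
move=> phi0 mphi.
(* The second kernel in [integral_kcomp] lives on [X * Y], so [g] is made to ignore the first
   component. *)
have mg : measurable_fun [set: X * Y] (g \o snd : X * Y -> pprobability Z R).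
  by apply: measurableT_comp => //; exact: measurable_funPT.
exact: (@integral_kcomp _ _ _ _ _ _ _
  (kprobability (@measurable_funPT _ _ _ _ f)) (kprobability mg) x phi phi0 mphi).
Qed.

Lemma integral_det d d' (X : measurableType d) (Y : measurableType d')
    (f : {mfun X >-> Y}) (x : X) (phi : Y -> \bar R) :
  measurable_fun [set: Y] phi ->
  \int[(det R f x : probability Y R)]_y phi y = phi (f x).
Proof.
by move=> mphi; rewrite [LHS]integral_dirac// diracT mul1e.
Qed.

Lemma integral_id_tensor d d' (X : measurableType d) (Y : measurableType d')
    (f : channel R X Y) (p : bool * X) (phi : bool * Y -> \bar R) :
  (forall z, 0 <= phi z) -> measurable_fun [set: bool * Y] phi ->
  \int[(id_tensor f p : probability (bool * Y)%type R)]_z phi z =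
  \int[(f p.2 : probability Y R)]_y phi (p.1, y).
Proof.
move=> phi0 mphi.
rewrite [LHS](@fubini_tonelli1 _ _ _ _ _
  (\d_(p.1) : probability bool R) (f p.2 : probability Y R) phi mphi phi0).
rewrite integral_dirac//.
by rewrite diracT mul1e.
Qed.

Lemma integral_bern (r : unit_interval R) (phi : bool * unit_interval R -> \bar R) :
  (forall z, 0 <= phi z) -> measurable_fun [set: bool * unit_interval R] phi ->
  \int[(bern R r : probability (bool * unit_interval R)%type R)]_z phi z =
  (unit_interval_val r)%:E * phi (true, r) +
  (1 - unit_interval_val r)%:E * phi (false, r).
Proof.
move=> phi0 mphi.
have /andP[r0 r1] := unit_interval_val01 r.
have r1' : (0 <= 1 - unit_interval_val r)%R by rewrite subr_ge0.
rewrite (eq_measure_integral (measure_add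
  (mscale (NngNum r0) \d_(true, r)) (mscale (NngNum r1') \d_(false, r)))); last first.
  by move=> A mA _; rewrite [RHS]measure_addE.
rewrite ge0_integral_measure_add// !ge0_integral_mscale// !integral_dirac//.
by rewrite !diracT !mul1e.
Qed.

End channel_integrals.

(** * Observation operators of a coalgebra *)

Section observation.
Local Open Scope ereal_scope.
Context (R : realType) d (X : measurableType d) (h : coalgebra R X).

(** The operator [T_b], with [false] for 0 and [true] for 1. *)
Definition obs (b : bool) (phi : X -> \bar R) (x : X) : \bar R :=
  \int[(h x : probability (bool * X)%type R)]_p (if p.1 == b then phi p.2 else 0).

Lemma measurable_obs_integrand d' (Y : measurableType d') b (phi : Y -> \bar R) :
  measurable_fun [set: Y] phi ->
  measurable_fun [set: bool * Y] (fun p => if p.1 == b then phi p.2 else 0).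
Proof.
move=> mphi; apply: measurable_fun_ifT => //=.
- apply: (measurable_fun_bool true) => //=.
  rewrite setTI (_ : _ @^-1` _ = [set b] `*` setT); last first.
    by apply/seteqP; split => -[c y] /=; [move/eqP => -> //|move=> [-> _]; rewrite eqxx].
  exact: measurableX.
- exact: measurableT_comp.
Qed.

Lemma obs_ge0 b phi : (forall x, 0 <= phi x) -> forall x, 0 <= obs b phi x.
Proof. by move=> phi0 x; apply: integral_ge0 => p _; case: ifP. Qed.

Lemma measurable_obs b phi : (forall x, 0 <= phi x) ->
  measurable_fun [set: X] phi -> measurable_fun [set: X] (obs b phi).
Proof.
move=> phi0 mphi; apply: measurable_channel_integral.
  by move=> p; case: ifP.
exact: measurable_obs_integrand.
Qed.

Lemma obsD b phi psi : (forall x, 0 <= phi x) -> measurable_fun [set: X] phi ->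
    (forall x, 0 <= psi x) -> measurable_fun [set: X] psi ->
  obs b (fun x => phi x + psi x) = (fun x => obs b phi x + obs b psi x).
Proof.
move=> phi0 mphi psi0 mpsi; apply/funext => x.
rewrite /obs -ge0_integralD//; last 4 first.
- by move=> p _; case: ifP.
- exact: measurable_obs_integrand.
- by move=> p _; case: ifP.
- exact: measurable_obs_integrand.
by apply: eq_integral => p _; case: ifP => //; rewrite adde0.
Qed.

Lemma obs1D x : obs false (cst 1) x + obs true (cst 1) x = 1.
Proof.
rewrite /obs -ge0_integralD//; last 4 first.
- by move=> p _; case: ifP.
- exact: measurable_obs_integrand.
- by move=> p _; case: ifP.
- exact: measurable_obs_integrand.
rewrite (eq_integral (cst 1)).
  by rewrite integral_cst// mul1e; exact: probability_setT.
by move=> [[] y] _ /=; rewrite ?adde0 ?add0e.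
Qed.

(** Both sides integrate, against the two-step channel, a function [Phi] testing the two outputs;
    swapping the outputs exchanges the tests. *)
Lemma obsC a b phi : exchangeable h ->
    (forall x, 0 <= phi x) -> measurable_fun [set: X] phi ->
  obs a (obs b phi) = obs b (obs a phi).
Proof.
move=> ex phi0 mphi.
pose Phi a b (p : bool * (bool * X)) : \bar R :=
  if p.1 == a then if p.2.1 == b then phi p.2.2 else 0 else 0.
have Phi0 a' b' p : 0 <= Phi a' b' p by rewrite /Phi; case: ifP => // _; case: ifP.
have mPhi a' b' : measurable_fun [set: bool * (bool * X)] (Phi a' b').
  exact: (measurable_obs_integrand a' (measurable_obs_integrand b' mphi)).
have obs2 a' b' x : obs a' (obs b' phi) x =
    \int[(kleisli (id_tensor h) h x : probability _ R)]_p Phi a' b' p.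
  rewrite integral_kleisli//; apply: eq_integral => -[c y] _.
  rewrite integral_id_tensor//= /Phi/=; case: ifP => // _.
  by rewrite integral0.
apply/funext => x; rewrite !obs2.
rewrite -(eq_channel_integral _ _ ex) integral_kleisli//.
apply: eq_integral => p _; rewrite integral_det//.
by case: p => -[] [[] y]; rewrite /Phi /=; case: a; case: b.
Qed.

End observation.

Section outputs.
Local Open Scope ereal_scope.
Context (R : realType) d (X : measurableType d) (h : coalgebra R X).

(** The function [c i j] of the state: the probability of [i] zeros followed by [j] ones. *)
Definition outputs i j : X -> \bar R :=
  iter i (obs h false) (iter j (obs h true) (cst 1)).

Lemma outputs_measurable_ge0 i j :
  (forall x, 0 <= outputs i j x) /\ measurable_fun [set: X] (outputs i j).
Proof.
elim: i => [|i [IH0 IH]]; last by split; [exact: obs_ge0|exact: measurable_obs].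
elim: j => [|j [IH0 IH]]; last by split; [exact: obs_ge0|exact: measurable_obs].
by split; [move=> x /=|exact: measurable_cst].
Qed.

Let outputs_ge0 i j x : 0 <= outputs i j x.
Proof. by have [+ _] := outputs_measurable_ge0 i j; exact. Qed.

Let measurable_outputs i j : measurable_fun [set: X] (outputs i j).
Proof. by have [] := outputs_measurable_ge0 i j. Qed.

Hypothesis ex : exchangeable h.

(** Exchangeability enters here: [T_1] moves past each [T_0]. *)
Lemma outputs_true_comm i j : obs h true (outputs i j) = outputs i j.+1.
Proof.
elim: i => [//|i IH]; rewrite -[outputs i.+1 j]/(obs h false (outputs i j)).
by rewrite obsC// IH.
Qed.

(** The case [1 = T_0 1 + T_1 1] is propagated by additivity of the operators and by commutation. *)
Lemma outputsE i j x : outputs i j x = outputs i.+1 j x + outputs i j.+1 x.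
Proof.
suff -> : outputs i j = (fun x => outputs i.+1 j x + outputs i j.+1 x) by [].
have obs_outputsD b k l m n : obs h b (fun x => outputs k l x + outputs m n x) =
    (fun x => obs h b (outputs k l) x + obs h b (outputs m n) x).
  apply: obsD; [exact: outputs_ge0|exact: measurable_outputs|
                exact: outputs_ge0|exact: measurable_outputs].
elim: i => [|i IH].
  elim: j => [|j IH]; first by apply/funext => y; exact: (esym (obs1D h y)).
  transitivity (obs h true (outputs 0 j)); first by [].
  by rewrite {1}IH obs_outputsD !outputs_true_comm.
transitivity (obs h false (outputs i j)); first by [].
by rewrite {1}IH obs_outputsD.
Qed.

Lemma outputs_le1 i j x : outputs i j x <= 1.
Proof.
elim: i => [|i IH]; last by rewrite (le_trans _ IH)// [leRHS]outputsE leeDl.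
by elim: j => [//|j IH]; rewrite (le_trans _ IH)// [leRHS]outputsE leeDr.
Qed.

Lemma outputs_fin_num i j x : outputs i j x \is a fin_num.
Proof. by rewrite ge0_fin_numE// (le_lt_trans (outputs_le1 i j x))// ltry. Qed.

Lemma completely_monotone_outputs x :
  completely_monotone (fun i j => fine (outputs i j x)).
Proof.
split => i j; first exact: fine_ge0.
by rewrite [in LHS]outputsE fineD// outputs_fin_num.
Qed.

End outputs.

(** * Coalgebra maps to [bern] in terms of moments *)

Section coalgebra_map.
Local Open Scope ereal_scope.
Context (R : realType) d (X : measurableType d) (h : coalgebra R X)
  (f : channel R X (unit_interval R)).
Local Notation I := (unit_interval R).
Local Notation val := (@unit_interval_val R).

Definition moment n (x : X) : \bar R :=
  \int[(f x : probability I R)]_r (val r ^+ n)%:E.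

Let val_ge0 (r : I) : (0 <= val r)%R.
Proof. by case/andP: (unit_interval_val01 r). Qed.

Let measurable_valX n : measurable_fun [set: I] (fun r => (val r ^+ n)%:E).
Proof.
exact/measurable_EFinP/measurable_funX/measurable_unit_interval_val.
Qed.

Let valX_ge0 n (r : I) : 0 <= (val r ^+ n)%:E.
Proof. by rewrite lee_fin exprn_ge0. Qed.

(** Test functions that determine a finite measure on [bool * I]: for each [b], the moments of its
    slice. *)
Let psi b n (p : bool * I) : \bar R := if p.1 == b then (val p.2 ^+ n)%:E else 0.

Let psi_ge0 b n p : 0 <= psi b n p.
Proof. by rewrite /psi; case: ifP. Qed.

Let measurable_psi b n : measurable_fun [set: bool * I] (psi b n).
Proof. exact: (measurable_obs_integrand b (measurable_valX n)). Qed.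

Lemma integral_bern_kleisli b n x :
  \int[(kleisli (bern R) f x : probability (bool * I)%type R)]_p psi b n p =
  \int[(f x : probability I R)]_r
    ((if b then val r else 1 - val r) * val r ^+ n)%:E.
Proof.
rewrite integral_kleisli//; apply: eq_integral => r _.
rewrite integral_bern// /psi/=; case: b => /=.
  by rewrite mule0 adde0 EFinM.
by rewrite mule0 add0e EFinM.
Qed.

Lemma integral_tensor_kleisli b n x :
  \int[(kleisli (id_tensor f) h x : probability (bool * I)%type R)]_p psi b n p =
  obs h b (moment n) x.
Proof.
rewrite integral_kleisli//; apply: eq_integral => -[c y] _.
by rewrite integral_id_tensor// /psi/=; case: ifP => // _; rewrite integral0.
Qed.

Lemma moment0 x : moment 0 x = 1.
Proof.
rewrite /moment; under eq_integral do rewrite expr0.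
by rewrite integral_cst// mul1e; exact: probability_setT.
Qed.

(** Testing the coalgebra map equation on [psi true n] gives [m_(n+1) = T_1 m_n]. *)
Lemma moment_coalgebra_map n x :
  channel_eq (kleisli (bern R) f) (kleisli (id_tensor f) h) ->
  moment n x = outputs h 0 n x.
Proof.
move=> fh; elim: n x => [|n IH] x; first exact: moment0.
have := integral_bern_kleisli true n x; rewrite (eq_channel_integral _ _ fh).
rewrite integral_tensor_kleisli /moment => /esym.
under eq_integral do rewrite -exprS.
move=> ->; rewrite /=; congr (obs h true _ x); apply/funext => y; exact: IH.
Qed.

(** It suffices to compare both sides on [psi b n]. For [b = true] this is the recurrence of the
    moments; [b = false] follows by complement. *)
Lemma coalgebra_map_of_moments : exchangeable h ->
  (forall n x, moment n x = outputs h 0 n x) ->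
  channel_eq (kleisli (bern R) f) (kleisli (id_tensor f) h).
Proof.
move=> ex fM x U mU.
have momentE n : moment n = outputs h 0 n by apply/funext => y; exact: fM.
have psiE b n : \int[(kleisli (bern R) f x : probability (bool * I)%type R)]_p psi b n p =
    \int[(kleisli (id_tensor f) h x : probability (bool * I)%type R)]_p psi b n p.
  rewrite integral_bern_kleisli integral_tensor_kleisli momentE.
  have valX1 : \int[(f x : probability I R)]_r (val r * val r ^+ n)%:E =
      outputs h 0 n.+1 x.
    by rewrite -momentE /moment; under eq_integral do rewrite -exprS.
  case: b => //.
  (* Adding the finite [outputs h 0 n.+1 x] to both sides turns them into the moment of order [n]
     and, by [outputsE], [outputs h 0 n x]. *)
  rewrite -[obs _ _ _]/(outputs h 1 n).
  have fin := outputs_fin_num ex 0 n.+1 x.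
  rewrite -[LHS](addeK _ fin) -[RHS](addeK _ fin); congr (_ - _).
  rewrite -(outputsE ex) -[in LHS]valX1 -ge0_integralD//; last 4 first.
  - move=> r _; rewrite lee_fin mulr_ge0 ?exprn_ge0// subr_ge0.
    by case/andP: (unit_interval_val01 r).
  - apply/measurable_EFinP/measurable_funM.
      exact/measurable_funB/measurable_unit_interval_val.
    exact/measurable_funX/measurable_unit_interval_val.
  - by move=> r _; rewrite lee_fin mulr_ge0// exprn_ge0.
  - under eq_fun do rewrite -exprS; exact: measurable_valX.
  rewrite -momentE; apply: eq_integral => r _.
  by rewrite -EFinD -mulrDl subrK mul1r.
have msnd b : measurable ([set b] `*` [set: I] : set (bool * I)).
  exact: measurableX.
have slice b V : measurable V ->
    (kleisli (bern R) f x : probability (bool * I)%type R)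
      (([set b] `*` setT) `&` snd @^-1` V) =
    (kleisli (id_tensor f) h x : probability (bool * I)%type R)
      (([set b] `*` setT) `&` snd @^-1` V).
  move=> mV; apply: moments_determine_preimage => // n.
  have := psiE b n; rewrite /psi => E.
  (* Integrating a power over the slice is integrating [psi b n] over the whole space. *)
  rewrite integral_mkcond [RHS]integral_mkcond.
  have patchE' : (fun p : bool * I => (val p.2 ^+ n)%:E) \_ ([set b] `*` setT) =
      psi b n.
    apply/funext => -[c r]; rewrite patchE /psi/=; case: ifPn.
      by rewrite inE/= => -[-> _]; rewrite eqxx.
    by rewrite notin_setE/=; case: eqP => // -> [].
  by rewrite patchE' E.
pose V b := [set r | U (b, r)].
have mV b : measurable (V b).
  rewrite (_ : V b = xsection U b); first exact: measurable_xsection.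
  by rewrite xsectionE.
have UE : U = (([set true] `*` setT) `&` snd @^-1` V true) `|`
              (([set false] `*` setT) `&` snd @^-1` V false).
  apply/seteqP; split => p.
    by case: p => -[] r Ur; [left|right].
  by case: p => c r [] [[/= ->]].
have dis : (([set true] `*` [set: I]) `&` snd @^-1` V true) `&`
           (([set false] `*` setT) `&` snd @^-1` V false) = set0.
  by apply/seteqP; split => // p; case: p => c r [[[/= ->]] _ _ [[]]].
have ms b : measurable (([set b] `*` [set: I]) `&` snd @^-1` V b).
  apply: measurableI => //; rewrite -[X in measurable X]setTI.
  exact: measurable_snd.
by rewrite UE [LHS]measureU// [RHS]measureU//; congr (_ + _); exact: slice.
Qed.

End coalgebra_map.

(** * Exchangeability and finality of [bern] *)

Lemma exchangeable_bern (R : realType) : exchangeable (bern R).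
Proof.
move=> r U mU; set nu := kleisli (id_tensor (bern R)) (bern R).
have indicE' (m : probability (bool * (bool * unit_interval R))%type R) :
    m U = (\int[m]_p (\1_U p)%:E)%E.
  by rewrite integral_indic// setIT.
(* The state stays at [r], so two steps give the outputs product weights, symmetric in them. A
   general [w] covers the indicator of [U] both with and without the swap. *)
have nuE (w : bool * (bool * unit_interval R) -> R) :
    (forall p, 0 <= w p) -> measurable_fun setT w ->
    (\int[(nu r : probability (bool * (bool * unit_interval R))%type R)]_p (w p)%:E)%E =
    (let t := unit_interval_val r in
     t * (t * w (true, (true, r)) + (1 - t) * w (true, (false, r))) +
     (1 - t) * (t * w (false, (true, r)) + (1 - t) * w (false, (false, r))))%:E.
  move=> w0 mw; have w0' p : (0 <= (w p)%:E)%E by rewrite lee_fin.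
  have mw' : measurable_fun setT (fun p => (w p)%:E) by exact/measurable_EFinP.
  rewrite /nu integral_kleisli// integral_bern//; last 2 first.
  - by move=> p; exact: integral_ge0.
  - exact: measurable_channel_integral.
  rewrite !integral_id_tensor// !integral_bern//=.
  - exact: (measurableT_comp mw' (measurable_pair1 false)).
  - exact: (measurableT_comp mw' (measurable_pair1 true)).
have m1U : measurable_fun setT (\1_U : _ -> R) by exact: measurable_indic.
have swapU : measurable_fun setT (fun p => \1_U (swap_id _ p) : R).
  by apply: measurableT_comp => //; exact: measurable_funPT.
rewrite !indicE' integral_kleisli//; last exact/measurable_EFinP.
have mU1 : measurable_fun setT (fun p => (\1_U p : R)%:E) by exact/measurable_EFinP.
under eq_integral do rewrite (integral_det _ _ mU1).
rewrite !nuE//=; congr EFin; rewrite /swap_id_fun/=; ring.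
Qed.

Theorem theorem12 (R : realType) :
  exchangeable (bern R) /\
  forall (d : measure_display) (X : measurableType d) (h : coalgebra R X),
    exchangeable h ->
    exists f : channel R X (unit_interval R),
      channel_eq (kleisli (bern R) f) (kleisli (id_tensor f) h) /\
      forall f' : channel R X (unit_interval R),
        channel_eq (kleisli (bern R) f') (kleisli (id_tensor f') h) ->
        channel_eq f' f.
Proof.
split; first exact: exchangeable_bern.
move=> d X h ex.
have /choice[f0 f0M] x : exists mu : probability (unit_interval R) R, forall n,
    (\int[mu]_r (unit_interval_val r ^+ n)%:E)%E = outputs h 0 n x.
  (* Here [erefl] proves [c 0 0 = 1], since [outputs h 0 0] computes to the constant 1. *)
  have [mu muE] := hausdorff_moment (completely_monotone_outputs ex x) erefl.
  by exists mu => n; rewrite muE fineK// outputs_fin_num.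
(* The pointwise choice is measurable because its moments are the measurable functions
   [outputs h 0 n]. *)
have mf0 : measurable_fun [set: X] (f0 : X -> pprobability (unit_interval R) R).
  apply: measurable_to_pprobability; apply: measurable_moments => n.
  under eq_fun do rewrite f0M.
  by have [] := outputs_measurable_ge0 h 0 n.
pose f : channel R X (unit_interval R) :=
  HB.pack (f0 : X -> pprobability (unit_interval R) R)
    (isMeasurableFun.Build _ _ _ _ (f0 : X -> pprobability _ R) mf0).
exists f; have fh := coalgebra_map_of_moments (f := f) ex (fun n x => f0M x n).
split => // f' f'h x U mU.
(* Both channels have the moments [outputs h 0 n], which determine them. *)
rewrite -[U]setTI -[X in _ `&` X]preimage_id.
apply: (moments_determine_preimage (g := id)) => // n.
by have := moment_coalgebra_map n x f'h; rewrite -(moment_coalgebra_map n x fh).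
Qed.
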